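(* Let $P, Q$ be two cumulative distribution functions on $\mathbb{R}$ satisfying Assumption 0 (defined in the context), with pdfs $p, q$ and supports $[c_P,+\infty)$ and $[c_Q,+\infty)$ respectively. Suppose that $P$ has no atom (i.e. its starting mass is $p_0=0$), that $c_Q \ge c_P$, that $P$ and $Q$ have finite mean, that $c_P \ge 0$, and that the starting mass $q_0$ of $Q$ is $0$. Define $$\Delta(Q\mid P) := \int_{c_Q}^{+\infty} \left| 1 - \frac{r_P(x)}{r_Q(x)} \right| q(x)\, dx, \qquad \Delta_w(Q\mid P) := \int_{c_Q}^{+\infty} x\left| 1 - \frac{r_P(x)}{r_Q(x)} \right| q(x)\, dx,$$ both in $[0,+\infty]$, and let $\mu$ be the mean of $P$. Then $$\mathrm{Wass}(P,Q) \le 2\mu\,\Delta(Q\mid P) + 3\,\Delta_w(Q\mid P).$$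
   Context: Assumption 0 for a cumulative distribution function (cdf) $F$ on $\mathbb{R}$: there exist a starting mass $f_0 \ge 0$, a left endpoint $c_F \in [-\infty,+\infty)$, and an integrable function $f:\mathbb{R}\to[0,+\infty)$ such that $F(x) = 0$ for $x < c_F$ and $F(x) = f_0 + \int_{c_F}^x f(u)\,du$ for $x \ge c_F$; moreover $f$ is continuous and strictly positive on $(c_F,+\infty)$. The function $f$ is called the pdf of $F$, and $[c_F,+\infty)$ its support. Thus $F$ may have a single atom, of mass $f_0$, at $c_F$. Reverse hazard rate: for $F$ satisfying Assumption 0 with pdf $f$, $r_F(x) = \frac{f(x)}{F(x)}\,\mathbb{I}_{(c_F,+\infty)}(x)$, where $\mathbb{I}_A$ is the indicator function of $A$. Wasserstein-1 distance: for a cdf $F$ and a test function $h$, $F(h) = \int_{\mathbb{R}} h\, dF$. Then $\mathrm{Wass}(P,Q) = \sup_{h} |P(h) - Q(h)|$, the supremum being over all Lipschitz functions $h:\mathbb{R}\to\mathbb{R}$ with Lipschitz constant $1$. *)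

(* Defs.v *)
From HB Require Import structures.
From mathcomp Require Export all_boot all_order all_algebra.
From mathcomp Require Export all_classical all_reals all_analysis.

Set Implicit Arguments.
Unset Strict Implicit.
Unset Printing Implicit Defensive.

Import Order.TTheory GRing.Theory Num.Theory.
Import numFieldNormedType.Exports.

Local Open Scope classical_set_scope.
Local Open Scope ring_scope.

(* Nondecreasing right-continuous functions with limits 0 at -oo and 1 at +oo. *)
Notation cdfType R := (@cumulativeBounded R 0 1).

(* [f0] is the starting mass, i.e. the mass of the only possible atom, which
   sits at the left endpoint [c] of the support; [f] is the pdf, whose
   values outside ]c, +oo[ are irrelevant. *)
Record has_pdf (R : realType) (F : cdfType R) (f0 : R) (c : \bar R)
    (f : R -> R) : Prop := HasPdf {
  starting_mass_ge0 : 0 <= f0 ;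
  left_endpoint_lty : (c < +oo)%E ;
  pdf_ge0 : forall x, 0 <= f x ;
  pdf_integrable : lebesgue_measure.-integrable [set: R] (EFin \o f) ;
  cdf_below : forall x : R, (x%:E < c)%E -> F x = 0 ;
  cdf_above : forall x : R, (c <= x%:E)%E ->
    F x = f0 + \int[lebesgue_measure]_(u in [set u : R | (c <= u%:E)%E /\ u <= x]) f u ;
  pdf_continuous : {within [set x : R | (c < x%:E)%E], continuous f} ;
  pdf_gt0 : forall x : R, (c < x%:E)%E -> 0 < f x }.

Definition reverse_hazard (R : realType) (F : cdfType R) (c : \bar R)
    (f : R -> R) (x : R) : R :=
  f x / F x * \1_[set y : R | (c < y%:E)%E] x.

Definition cdf_integral (R : realType) (F : cdfType R) (h : R -> R) : \bar R :=
  \int[lebesgue_stieltjes_measure F]_x (h x)%:E.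

Definition finite_mean (R : realType) (F : cdfType R) : Prop :=
  (lebesgue_stieltjes_measure F).-integrable [set: R] (EFin \o idfun).

Definition mean (R : realType) (F : cdfType R) : \bar R := cdf_integral F idfun.

(* If both integrals are +oo, or both -oo, their difference is -oo, so that
   such an [h] contributes +oo; this cannot happen under [finite_mean]. *)
Definition Wass (R : realType) (P Q : cdfType R) : \bar R :=
  ereal_sup [set `|cdf_integral P h - cdf_integral Q h|%E
            | h in [set h : R -> R | 1.-lipschitz h]].

(* [Delta] and [Delta_w] integrate over the open half-line: its endpoint is
   Lebesgue-null, and the reverse hazard rate of [Q] vanishes there. *)
Definition Delta (R : realType) (Q : cdfType R) (cQ : \bar R) (q : R -> R)
    (P : cdfType R) (cP : \bar R) (p : R -> R) : \bar R :=
  \int[lebesgue_measure]_(x in [set x : R | (cQ < x%:E)%E])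
    (`|1 - reverse_hazard P cP p x / reverse_hazard Q cQ q x| * q x)%:E.

Definition Delta_w (R : realType) (Q : cdfType R) (cQ : \bar R) (q : R -> R)
    (P : cdfType R) (cP : \bar R) (p : R -> R) : \bar R :=
  \int[lebesgue_measure]_(x in [set x : R | (cQ < x%:E)%E])
    (x * `|1 - reverse_hazard P cP p x / reverse_hazard Q cQ q x| * q x)%:E.

(* Main.v *)
(* One has the stronger bound Wass(P, Q) <= Delta_w(Q | P). Coupling P and Q
   through their quantile functions and exchanging integrals gives
   Wass(P, Q) <= \int |P - Q|. On ]c_Q, +oo[ the ratio Q / P is differentiable,
   tends to 1 at +oo, and satisfies P |(Q / P)'| = |1 - r_P / r_Q| q =: g. Since P
   is nondecreasing, |P(x) - Q(x)| = P(x) |1 - Q(x) / P(x)| is at most the integral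
   of g over [x, +oo[ for x > c_Q, hence at most its integral over
   [x, +oo[ `&` ]c_Q, +oo[ for all x, because Q vanishes up to c_Q and P is
   nondecreasing. Integrating over x >= 0, Tonelli turns the bound into
   \int u g(u) du = Delta_w(Q | P). *)

Require Import Defs.
From HB Require Import structures.
From mathcomp Require Import measurable_realfun ring.

Set Implicit Arguments.
Unset Strict Implicit.
Unset Printing Implicit Defensive.
Import Order.TTheory GRing.Theory Num.Theory.
Import numFieldNormedType.Exports.

Local Open Scope classical_set_scope.
Local Open Scope ring_scope.

(** * Quantile functions and the change of variables they provide *)

Section quantile.
Context {R : realType}.
Implicit Types (F : cdfType R) (u x : R).

Lemma cumulative01_ge0 F x : 0 <= F x.
Proof.
rewrite leNgt; apply/negP => Fx0.
near (-oo : set_system R) => y.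
have : F y <= F x.
  by apply: cumulative_is_nondecreasing; near: y; apply: nbhs_ninfty_le; exact: num_real.
by apply/negP; rewrite -ltNge; near: y; exact: cvgr_gt (cumulativeNy F) _ Fx0.
Unshelve. all: end_near. Qed.

Lemma cumulative01_le1 F x : F x <= 1.
Proof.
rewrite leNgt; apply/negP => Fx1.
near (+oo : set_system R) => y.
have : F x <= F y.
  by apply: cumulative_is_nondecreasing; near: y; apply: nbhs_pinfty_ge; exact: num_real.
by apply/negP; rewrite -ltNge; near: y; exact: cvgr_lt (cumulativey F) _ Fx1.
Unshelve. all: end_near. Qed.

(** The uniform law, carried by the whole line so that integrals run over [setT]. The endpoints are
    left out because quantiles may be infinite there. *)
Definition unit_lebesgue : set (measurableTypeR R) -> \bar R :=
  mrestr lebesgue_measure (measurable_itv `]0, 1[).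

HB.instance Definition _ := Measure.on unit_lebesgue.

Let unit_lebesgue_fin : fin_num_fun unit_lebesgue.
Proof.
move=> A mA; rewrite ge0_fin_numE//.
apply: (@le_lt_trans _ _ (lebesgue_measure (`]0%R, 1%R[ : set R))).
  by rewrite /unit_lebesgue /mrestr le_measure ?inE//; exact: measurableI.
by rewrite lebesgue_measure_itv/= lte_fin ltr01 -EFinB ltry.
Qed.

HB.instance Definition _ :=
  Measure_isFinite.Build _ _ _ unit_lebesgue unit_lebesgue_fin.

(** The case [b = 1] is separate: the restriction removes the point 1, which is Lebesgue-null. *)
Lemma unit_lebesgue_itv (a b : R) : 0 <= a -> a <= b -> b <= 1 ->
  unit_lebesgue `]a, b] = (b - a)%:E.
Proof.
move=> a0 ab b1; rewrite /unit_lebesgue /mrestr.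
have [b_lt1|b_ge1] := ltP b 1.
  rewrite setIidl => [|u /=].
    rewrite lebesgue_measure_itv/= lte_fin; case: ltP => // ba.
    by rewrite (@le_anti _ _ a b) ?subrr// ab ba.
  rewrite !in_itv/= => /andP[au ub].
  by rewrite (le_lt_trans a0 au) (le_lt_trans ub b_lt1).
have -> : b = 1 by apply/eqP; rewrite eq_le b1.
have -> : `]a, 1] `&` `]0, 1[ = `]a, 1[%classic :> set R.
  apply/seteqP; split=> u /=; rewrite !in_itv/=.
    by case=> /andP[-> _] /andP[].
  by move=> /andP[au u1]; rewrite au u1 (ltW u1) (le_lt_trans a0 au).
rewrite lebesgue_measure_itv/= lte_fin; case: ltP => // a1.
by rewrite (@le_anti _ _ a 1) ?subrr// a1 andbT (le_trans ab b1).
Qed.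

(** The generalized inverse of [F]. The value 0 outside []0, 1[] is a default, invisible to
    [unit_lebesgue]. *)
Definition quantile F : R -> R :=
  (fun u => inf [set x | u <= F x]) \_ `]0, 1[.

(** A Galois connection: right-continuity makes the infimum attained. Every later fact about
    quantiles of levels in []0, 1[] goes through it. *)
Lemma quantile_le F u x : 0 < u < 1 -> (quantile F u <= x) = (u <= F x).
Proof.
move=> /[dup] u01 /andP[u0 u1]; rewrite /quantile patchE mem_set; last first.
  by rewrite /= in_itv/= u01.
set A := [set x | u <= F x].
have [y Fy] : exists y, F y < u.
  by near (-oo : set_system R) => y; exists y; near: y; exact: cvgr_lt (cumulativeNy F) _ u0.
have lbA : lbound A y.
  move=> z /= uz; rewrite leNgt; apply/negP => zy.
  by have := cumulative_is_nondecreasing F _ _ (ltW zy); rewrite leNgt (lt_le_trans Fy uz).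
have A0 : A !=set0.
  by near (+oo : set_system R) => z; exists z; near: z; exact: cvgr_ge (cumulativey F) _ u1.
apply/idP/idP => [Ax|ux]; last by apply: ge_inf => //; exists y.
rewrite leNgt; apply/negP => Fxu.
(* Halving the difference keeps [F (x + d)] strictly below [u], so that [x + d] is a lower bound of
   the set [A]. *)
have eps : 0 < (u - F x) / 2 by rewrite divr_gt0// subr_gt0.
have [d dF] := nondecreasing_right_continuousP x F eps.
have : x + d%:num <= inf A.
  apply: lb_le_inf => // z /= uz; rewrite leNgt; apply/negP => zd.
  have := cumulative_is_nondecreasing F _ _ (ltW zd).
  apply/negP; rewrite -ltNge; apply: (le_lt_trans dF); apply: lt_le_trans uz.
  by rewrite -ltrBrDl ltr_pdivrMr// ltr_pMr ?subr_gt0// ltr1n.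
by move/le_trans/(_ Ax); rewrite gerDl leNgt gt0.
Unshelve. all: end_near. Qed.

Lemma quantile_out F u : ~ (0 < u < 1) -> quantile F u = 0.
Proof.
by move=> u01; rewrite /quantile patchE memNset//= in_itv.
Qed.

Lemma measurable_quantile F : measurable_fun [set: R] (quantile F).
Proof.
have m01 : measurable (`]0, 1[ : set R) := measurable_itv _.
rewrite /quantile; apply/(measurable_restrictT _ m01).
move=> mD; apply: (measurability (@RGenOInfty.G R)); [exact: RGenOInfty.measurableE| |exact: m01].
move=> _ [_ [r] -> <-].
suff -> : `]0, 1[ `&` (fun u => inf [set x | u <= F x]) @^-1` `]r, +oo[ =
          `]0, 1[ `&` `]F r, +oo[ by exact: measurableI.
apply/seteqP; split=> u /= [].
  rewrite !in_itv/= !andbT => u01; rewrite ltNge.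
  have := quantile_le F r u01; rewrite /quantile patchE mem_set/= ?in_itv//.
  by move=> -> ; rewrite -ltNge.
rewrite !in_itv/= !andbT => u01; rewrite ltNge -(quantile_le F r u01).
by rewrite /quantile patchE mem_set/= ?in_itv// -ltNge.
Qed.

(** By uniqueness of the extension it suffices to compare half-open intervals. By [quantile_le], the
    preimage of []a, b]] is []F a, F b]] within []0, 1[], of length [F b - F a]. *)
Lemma lebesgue_stieltjes_quantile F (A : set R) : measurable A ->
  lebesgue_stieltjes_measure F A =
  pushforward unit_lebesgue (quantile F : measurableTypeR R -> measurableTypeR R) A.
Proof.
move=> mA.
pose m : {measure set (measurableTypeR R) -> \bar R} :=
  pushforward unit_lebesgue (quantile F : measurableTypeR R -> measurableTypeR R).
suff H I : ocitv I -> lebesgue_stieltjes_measure F I = m (measurable_quantile F) I.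
  exact: (@lebesgue_stieltjes_measure_unique _ F (m (measurable_quantile F)) H).
case=> [[a b]]/= _ <-.
rewrite /lebesgue_stieltjes_measure /measure_extension/=.
rewrite measurable_mu_extE/=; last exact: is_ocitv.
have [ba|ab] := leP b a.
  by rewrite set_itv_ge ?bnd_simp -?leNgt// wlength0 /pushforward preimage_set0 measure0.
have Fab := cumulative_is_nondecreasing F _ _ (ltW ab).
rewrite wlength_itv_bnd//; last exact: ltW.
rewrite /pushforward /unit_lebesgue /mrestr.
have -> : quantile F @^-1` `]a, b] `&` `]0, 1[ = `]F a, F b] `&` `]0, 1[.
  apply/seteqP; split=> u /= [] /[swap]; rewrite !in_itv/= => u01.
    by rewrite quantile_le// ltNge quantile_le// -ltNge.
  by rewrite ltNge -!quantile_le// -ltNge.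
rewrite -[RHS]/(unit_lebesgue `]F a, F b]) EFinB unit_lebesgue_itv//.
- exact: cumulative01_ge0.
- exact: cumulative01_le1.
Qed.

Lemma ge0_integral_quantile F (h : R -> \bar R) :
  measurable_fun setT h -> (forall x, 0 <= h x)%E ->
  (\int[lebesgue_stieltjes_measure F]_x h x =
   \int[unit_lebesgue]_u h (quantile F u))%E.
Proof.
move=> mh h0.
pose m : {measure set (measurableTypeR R) -> \bar R} :=
  pushforward unit_lebesgue (quantile F : measurableTypeR R -> measurableTypeR R).
transitivity (\int[m (measurable_quantile F)]_x h x)%E.
  apply: eq_measure_integral => A mA _; exact: lebesgue_stieltjes_quantile.
rewrite /m/= ge0_integral_pushforward//; exact: measurable_quantile.
Qed.

Lemma cdf_integral_quantile F (h : R -> R) : measurable_fun setT h ->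
  unit_lebesgue.-integrable setT (fun u => (h (quantile F u))%:E) ->
  cdf_integral F h = (\int[unit_lebesgue]_u (h (quantile F u))%:E)%E.
Proof.
move=> mh ih; rewrite /cdf_integral.
pose m : {measure set (measurableTypeR R) -> \bar R} :=
  pushforward unit_lebesgue (quantile F : measurableTypeR R -> measurableTypeR R).
transitivity (\int[m (measurable_quantile F)]_x (h x)%:E)%E.
  apply: eq_measure_integral => A mA _; exact: lebesgue_stieltjes_quantile.
rewrite /m/= integral_pushforward//.
- exact: measurable_quantile.
- exact/measurable_EFinP.
Qed.

Lemma finite_mean_quantile F : finite_mean F ->
  unit_lebesgue.-integrable setT (EFin \o quantile F).
Proof.
move=> /integrableP[_ iF]; apply/integrableP; split.
  apply/measurable_EFinP; exact: measurable_quantile.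
move: iF; rewrite ge0_integral_quantile//.
apply: measurableT_comp => //; apply/measurable_EFinP; exact: measurable_id.
Qed.

End quantile.

(** * Quantile coupling: the Wasserstein distance is at most the area between the cdfs *)

Section coupling.
Context {R : realType}.
Implicit Types (P Q F : cdfType R) (u x : R).

Lemma measurable_cdf F : measurable_fun [set: R] F.
Proof.
apply: nondecreasing_measurable => //; exact: cumulative_is_nondecreasing.
Qed.

(* By [quantile_le], the section at [u] is the interval between the two
   quantiles of [u], and the section at [x] the one between [P x] and [Q x]. *)
Let separated P Q : set (measurableTypeR R * measurableTypeR R) :=
  [set z | (0 < z.1 < 1) && ((z.1 <= P z.2) != (z.1 <= Q z.2))].

Let measurable_separated P Q : measurable (separated P Q).
Proof.
(* The disequality of booleans is spelled out with connectives that preserve measurability. *)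
pose b (z : measurableTypeR R * measurableTypeR R) :=
  ((0 < z.1) && (z.1 < 1)) &&
  (((z.1 <= P z.2) && ~~ (z.1 <= Q z.2)) ||
   (~~ (z.1 <= P z.2) && (z.1 <= Q z.2))).
have mb : measurable_fun setT b.
  have m1 := @measurable_fst _ _ (measurableTypeR R) (measurableTypeR R).
  have m2 F : measurable_fun setT
      ((F : R -> R) \o (@snd (measurableTypeR R) (measurableTypeR R))).
    apply: measurableT_comp; first exact: measurable_cdf.
    exact: measurable_snd.
  have mle F : measurable_fun setT
      (fun z : measurableTypeR R * measurableTypeR R => (z.1 : R) <= F z.2).
    exact: measurable_fun_ler m1 (m2 F).
  apply: measurable_and.
    by apply: measurable_and; apply: measurable_fun_ltr.
  by apply: measurable_or; apply: measurable_and => //; exact: measurable_neg.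
have -> : separated P Q = setT `&` b @^-1` [set true].
  rewrite setTI; apply/seteqP; split => z; rewrite /separated /b /=.
    by case: (z.1 <= P z.2); case: (z.1 <= Q z.2); rewrite /= ?andbT ?andbF.
  by case: (z.1 <= P z.2); case: (z.1 <= Q z.2); rewrite /= ?andbT ?andbF.
exact: mb.
Qed.

Let quantile_separated P Q u :
  (`|quantile P u - quantile Q u|%:E <=
   lebesgue_measure (xsection (separated P Q) u))%E.
Proof.
have [u01|/negP nu01] := boolP (0 < u < 1); last first.
  by rewrite !quantile_out// subrr normr0.
(* Both sides are symmetric in [P] and [Q]. *)
wlog le_qPQ : P Q / quantile P u <= quantile Q u.
  move=> H; have [/H//|/ltW/H] := leP (quantile P u) (quantile Q u).
  rewrite distrC; congr (_ <= lebesgue_measure (xsection _ _))%E.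
  by apply/seteqP; split => z; rewrite /separated/= (eq_sym (_ <= Q _)).
rewrite distrC ger0_norm ?subr_ge0//.
apply: (@le_trans _ _ (lebesgue_measure `[quantile P u, quantile Q u[)).
  rewrite lebesgue_measure_itv/= lte_fin; case: ltP => // le_qQP.
  by rewrite (@le_anti _ _ (quantile P u) (quantile Q u)) ?subrr// le_qPQ.
apply: le_measure; rewrite ?inE.
- exact: measurable_itv.
- by apply: measurable_xsection; exact: measurable_separated.
move=> x; rewrite /= in_itv/= ltNge !quantile_le// => /andP[uP uQ].
by rewrite xsectionE/= /separated/= u01 uP (negbTE uQ).
Qed.

Let separated_cdf P Q x :
  (unit_lebesgue (ysection (separated P Q) x) <= `|P x - Q x|%:E)%E.
Proof.
wlog le_PQ : P Q / P x <= Q x.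
  move=> H; have [/H//|/ltW/H] := leP (P x) (Q x).
  rewrite distrC; congr (unit_lebesgue (ysection _ _) <= _)%E.
  by apply/seteqP; split => z; rewrite /separated/= (eq_sym (_ <= Q _)).
rewrite distrC ger0_norm ?subr_ge0//.
rewrite -unit_lebesgue_itv ?cumulative01_ge0 ?cumulative01_le1//.
apply: le_measure; rewrite ?inE.
- by apply: measurable_ysection; exact: measurable_separated.
- exact: measurable_itv.
move=> u; rewrite ysectionE/= /separated/= in_itv/= => /andP[_].
have [uP|Pu] := leP u (P x); first by rewrite (le_trans uP le_PQ).
by case: (u <= Q x).
Qed.

(** The product measure of [separated P Q] is computed in two ways by Tonelli: its sections at [u]
    dominate the left integrand, those at [x] are dominated by the right one. *)
Lemma integral_quantile_dist P Q :
  (\int[unit_lebesgue]_u (`|quantile P u - quantile Q u|)%:E <=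
   \int[lebesgue_measure]_x (`|P x - Q x|)%:E)%E.
Proof.
have mA := measurable_separated P Q.
apply: (@le_trans _ _ (\int[unit_lebesgue]_u
    (lebesgue_measure \o xsection (separated P Q)) u)%E).
  apply: ge0_le_integral => //.
      apply/measurable_EFinP; apply: measurableT_comp => //.
      by apply: measurable_funB; exact: measurable_quantile.
    exact: measurable_fun_xsection.
rewrite -(indic_fubini_tonelli_FE lebesgue_measure mA).
rewrite indic_fubini_tonelli// indic_fubini_tonelli_GE//.
apply: ge0_le_integral => //.
- exact: measurable_fun_ysection.
- apply/measurable_EFinP; apply: measurableT_comp => //.
  by apply: measurable_funB; exact: measurable_cdf.
move=> x _; exact: separated_cdf.
Qed.

Lemma lipschitz1_dist (h : R -> R) : 1.-lipschitz h ->
  forall x y, `|h x - h y| <= `|x - y|.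
Proof. by move=> lh x y; have := lh (x, y) (conj I I); rewrite /= mul1r. Qed.

Lemma measurable_lipschitz1 (h : R -> R) : 1.-lipschitz h ->
  measurable_fun setT h.
Proof.
move=> lh; apply: measurable_realfun.continuous_measurable_fun => x.
apply/cvgrPdist_le => e e0; near=> y.
apply: le_trans (lipschitz1_dist lh _ _) _.
by near: y; exact: cvgr_dist_le.
Unshelve. all: end_near. Qed.

(** For a 1-Lipschitz [h], both integrals become integrals over the same variable [u], where the
    integrands differ by at most the distance between the quantiles. *)
Lemma Wass_le P Q : finite_mean P -> finite_mean Q ->
  (Wass P Q <= \int[lebesgue_measure]_x (`|P x - Q x|)%:E)%E.
Proof.
move=> fP fQ; apply: ge_ereal_sup => _ [h /= lh <-].
have ih F : finite_mean F ->
    unit_lebesgue.-integrable setT (fun u => (h (quantile F u))%:E).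
  move=> /finite_mean_quantile iF.
  (* The Lipschitz bound between a quantile and 0 dominates [h] by this sum, integrable since the
     mean is finite. *)
  have : unit_lebesgue.-integrable setT
      (fun u => (EFin \o cst `|h 0|%R) u + `|(EFin \o quantile F) u|)%E.
    apply: integrableD => //; last exact: integrable_abse.
    exact: finite_measure_integrable_cst.
  apply: le_integrable => //.
    apply/measurable_EFinP; apply: measurableT_comp.
      exact: measurable_lipschitz1.
    exact: measurable_quantile.
  move=> u _ /=; rewrite lee_fin [leRHS]ger0_norm ?addr_ge0//.
  have := lipschitz1_dist lh (quantile F u) 0; rewrite subr0 => hF.
  rewrite -lerBlDl; apply: le_trans hF; exact: lerB_dist.
have mlh := measurable_lipschitz1 lh.
rewrite (cdf_integral_quantile mlh (ih _ fP)) (cdf_integral_quantile mlh (ih _ fQ)).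
rewrite -integralB//; [|exact: ih|exact: ih].
apply: le_trans (integral_quantile_dist P Q).
have mh F : measurable_fun setT (fun u => h (quantile F u)).
  by apply: measurableT_comp; [exact: measurable_lipschitz1|exact: measurable_quantile].
have mhB : measurable_fun [set: measurableTypeR R]
    (fun u => ((h (quantile P u))%:E - (h (quantile Q u))%:E)%E).
  under eq_fun do rewrite -EFinB.
  by apply/measurable_EFinP; apply: measurable_funB; exact: mh.
apply: (le_trans (le_abse_integral _ measurableT mhB)).
apply: ge0_le_integral => //.
- exact: measurableT_comp.
- apply/measurable_EFinP; apply: measurableT_comp => //.
  by apply: measurable_funB; exact: measurable_quantile.
- by move=> u _; rewrite -EFinB lee_fin lipschitz1_dist.
Qed.

(** The mean is the integral of the quantile function, and a negative quantile of level [u > 0]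
    would force [u <= 0]. *)
Lemma mean_ge0 F : finite_mean F -> (forall x, x < 0 -> F x = 0) -> (0 <= mean F)%E.
Proof.
move=> fF F0.
rewrite /mean (cdf_integral_quantile (@measurable_id _ _ setT) (finite_mean_quantile fF)).
apply: integral_ge0 => u _; rewrite lee_fin.
have [u01|/negP nu01] := boolP (0 < u < 1); last by rewrite quantile_out.
rewrite leNgt; apply/negP => q0.
have := lexx (quantile F u); rewrite quantile_le// F0//.
by case/andP: u01 => u0 _; rewrite leNgt u0.
Qed.

End coupling.

(** * Differentiability and positivity of a cdf beyond a real left endpoint *)

Section has_pdf.
Context {R : realType} (F : cdfType R) (f0 a : R) (f : R -> R).
Hypothesis hF : has_pdf F f0 a%:E f.

Lemma cdf_aboveE x : a <= x ->
  F x = f0 + \int[lebesgue_measure]_(u in `[a, x]) f u.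
Proof.
move=> ax; rewrite (cdf_above hF) ?lee_fin//; congr (_ + Rintegral _ _ _).
by apply/seteqP; split=> u /=; rewrite in_itv/= lee_fin => /andP.
Qed.

Lemma continuous_pdf x : a < x -> {for x, continuous f}.
Proof.
move=> ax; have := pdf_continuous hF.
have -> : [set y : R | (a%:E < y%:E)%E] = `]a, +oo[%classic.
  by apply/seteqP; split=> u /=; rewrite in_itv/= andbT lte_fin.
rewrite continuous_open_subspace; last exact: interval_open.
by apply; rewrite inE/= in_itv/= ax.
Qed.

Lemma is_derive_cdf x : a < x -> is_derive x 1 F (f x).
Proof.
move=> ax; pose G y := \int[lebesgue_measure]_(u in `[a, y]) f u.
(* The bound [x + 1] only serves to make [x] an interior point. *)
have intf : lebesgue_measure.-integrable `[a, x + 1] (EFin \o f).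
  by apply: integrableS (pdf_integrable hF).
have x1 : x < x + 1 by rewrite ltrDl.
have [dG G'] := continuous_FTC1_closed x1 intf ax (continuous_pdf ax).
have : is_derive x 1 (cst f0 + G) (0 + f x).
  apply: is_deriveD; split=> //; by rewrite -derive1E.
rewrite add0r; apply: near_eq_is_derive.
near=> y; rewrite cdf_aboveE//.
by near: y; apply: filterS (lt_nbhsr ax) => ? /ltW.
Unshelve. all: end_near. Qed.

Lemma continuous_cdf x : a < x -> {for x, continuous F}.
Proof.
move=> ax; apply: differentiable_continuous; apply/derivable1_diffP.
by have [] := is_derive_cdf ax.
Qed.

(* If [F x] vanished, [F] would be constant left of [x], against [f > 0]. *)
Lemma cdf_gt0 x : a < x -> 0 < F x.
Proof.
move=> ax; rewrite lt0r cumulative01_ge0 andbT; apply/eqP => Fx0.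
have /midf_lt[am mx] := ax; set m := (a + x) / 2 in am mx.
have : is_derive m 1 F 0.
  have := is_derive_cst (0 : R) m (1 : R).
  apply: near_eq_is_derive.
  near=> y; apply/esym/le_anti; rewrite [cst _ _]/= cumulative01_ge0 andbT.
  rewrite [leRHS](esym Fx0); apply: cumulative_is_nondecreasing.
  by near: y; exact: lt_le_nbhsl.
move=> [_ F'0]; have [_] := is_derive_cdf am; rewrite F'0 => f0'.
by have := pdf_gt0 hF (am : (a%:E < m%:E)%E); rewrite -f0' ltxx.
Unshelve. all: end_near. Qed.

End has_pdf.

(** * The ratio [Q / P] and the area between the two cdfs *)

Section comparison.
Context {R : realType} (P Q : cdfType R) (a b : R) (p q : R -> R).
Hypotheses (hP : has_pdf P 0 a%:E p) (hQ : has_pdf Q 0 b%:E q).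
Hypothesis ab : a <= b.

Let ratio x := Q x / P x.

Let dratio x := (q x * P x - Q x * p x) / (P x * P x).

(** The function g of the overview, in the form produced by the derivative of [ratio]; [gapE]
    identifies it with the integrand of [Delta]. *)
Let gap x := `|dratio x| * P x.

Let is_derive_ratio x : b < x -> is_derive x 1 ratio (dratio x).
Proof.
move=> bx; have ax := le_lt_trans ab bx.
have P0 : P x != 0 by rewrite gt_eqF// (cdf_gt0 hP).
have dP := is_derive_cdf hP ax; have dQ := is_derive_cdf hQ bx.
have dV := is_deriveV P0 dP.
apply: is_derive_eq (is_deriveM dQ dV) _.
by rewrite /dratio /GRing.scale/=; field.
Qed.

Let continuous_dratio x : b < x -> {for x, continuous dratio}.
Proof.
move=> bx; have ax := le_lt_trans ab bx.
have P0 : P x != 0 by rewrite gt_eqF// (cdf_gt0 hP).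
have cP := continuous_cdf hP ax; have cQ := continuous_cdf hQ bx.
have cp := continuous_pdf hP ax; have cq := continuous_pdf hQ bx.
apply: cvgM.
  by apply: cvgB; apply: cvgM.
apply: cvgV; first by rewrite mulf_neq0.
exact: cvgM.
Qed.

Let measurable_gap : measurable_fun `]b, +oo[ (fun u => (gap u)%:E).
Proof.
apply/measurable_EFinP; apply: measurable_funM; last first.
  exact: measurable_funS (measurable_cdf P).
apply: measurableT_comp => //.
apply: open_continuous_measurable_fun; first exact: interval_open.
by move=> x; rewrite inE/= in_itv/= andbT; exact: continuous_dratio.
Qed.

Let gap_ge0 x : 0 <= gap x.
Proof. by rewrite mulr_ge0// cumulative01_ge0. Qed.

(** The increment is the integral of [dratio] over [[x, y]]; the factor [P x] moves inside, where it
    is at most [P u]. *)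
Let ratio_increment x y : b < x -> x < y ->
  ((P x * `|ratio y - ratio x|)%:E <=
   \int[lebesgue_measure]_(u in `[x, +oo[) (gap u)%:E)%E.
Proof.
move=> bx xy.
have cD : {within `[x, y], continuous dratio}.
  apply: continuous_in_subspaceT => z; rewrite inE/= in_itv/= => /andP[xz _].
  exact/continuous_dratio/(lt_le_trans bx).
have cr z : x <= z -> {for z, continuous ratio}.
  move=> xz; apply: differentiable_continuous; apply/derivable1_diffP.
  by have [] := is_derive_ratio (lt_le_trans bx xz).
have /esym FTC : (\int[lebesgue_measure]_(u in `[x, y]) (dratio u)%:E =
    (ratio y)%:E - (ratio x)%:E)%E.
  apply: continuous_FTC2 => //.
  - split.
    + move=> z; rewrite in_itv/= => /andP[xz _].
      by have [] := is_derive_ratio (lt_trans bx xz).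
    + by apply: cvg_at_right_filter; exact: cr.
    + by apply: cvg_at_left_filter; apply: cr; exact: ltW.
  - move=> z; rewrite in_itv/= => /andP[xz _].
    by rewrite derive1E; have [_] := is_derive_ratio (lt_trans bx xz).
have mD : measurable_fun (`[x, y] : set R) (EFin \o dratio).
  by apply/measurable_EFinP; exact: subspace_continuous_measurable_fun.
rewrite EFinM -abse_EFin EFinB FTC.
apply: (@le_trans _ _ ((P x)%:E * \int[lebesgue_measure]_(u in `[x, y]) `|(dratio u)%:E|)%E).
  by apply: lee_wpmul2l; [rewrite lee_fin cumulative01_ge0|exact: le_abse_integral].
rewrite -ge0_integralZl//; last 2 first.
- exact: measurableT_comp.
- by rewrite lee_fin cumulative01_ge0.
have mg : measurable_fun (`[x, +oo[ : set R) (fun u => (gap u)%:E).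
  apply: measurable_funS measurable_gap => // u/=.
  by rewrite !in_itv/= !andbT; exact: lt_le_trans.
have xyS : `[x, y] `<=` (`[x, +oo[ : set R).
  by move=> u/=; rewrite !in_itv/= andbT => /andP[].
apply: (@le_trans _ _ (\int[lebesgue_measure]_(u in `[x, y]) (gap u)%:E)%E).
  apply: ge0_le_integral => //.
  - by move=> u _; rewrite mule_ge0// lee_fin cumulative01_ge0.
  - by apply: emeasurable_funM => //; exact: measurableT_comp.
  - exact: measurable_funS mg.
  - move=> u; rewrite /= in_itv/= => /andP[xu _].
    rewrite -EFinM lee_fin mulrC ler_wpM2l//.
    exact: cumulative_is_nondecreasing.
apply: ge0_subset_integral => //.
by move=> u _; rewrite lee_fin.
Qed.

(** This is the limit of [ratio_increment] as [y] tends to +oo, since [ratio y] tends to 1. *)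
Let cdf_dist_tail x : b < x ->
  (`|P x - Q x|%:E <= \int[lebesgue_measure]_(u in `[x, +oo[) (gap u)%:E)%E.
Proof.
move=> bx; set G := (X in (_ <= X)%E).
have [Gfin|] := ltP G +oo%E; last by rewrite leye_eq => /eqP ->; rewrite leey.
have G0 : (0 <= G)%E by apply: integral_ge0 => u _; rewrite lee_fin.
have Gf : G \is a fin_num by rewrite ge0_fin_numE.
rewrite -(fineK Gf) lee_fin.
have Px0 : 0 < P x by rewrite (cdf_gt0 hP)// (le_lt_trans ab).
have -> : `|P x - Q x| = P x * `|1 - ratio x|.
  rewrite -{2}(gtr0_norm Px0) -normrM; congr (`| _ |).
  by rewrite /ratio; field; rewrite gt_eqF.
have cvgr : ratio y @[y --> +oo] --> (1 : R).
  rewrite -[X in _ --> X](divr1 1) /ratio.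
  apply: cvgM; first exact: cumulativey.
  by apply: cvgV; [exact: oner_neq0|exact: cumulativey].
apply: (@ler_cvg_to _ (+oo : set_system R) _ _ (fun y => P x * `|ratio y - ratio x|) (cst (fine G))).
- by apply: cvgMr; apply: cvg_norm; apply: cvgB => //; exact: cvg_cst.
- exact: cvg_cst.
- near=> y; rewrite -lee_fin (fineK Gf); apply: ratio_increment => //.
  by near: y; apply: nbhs_pinfty_gt; exact: num_real.
Unshelve. all: end_near. Qed.

(** The indicator makes the domain of integration independent of [x], in view of Tonelli, and covers
    the points [x <= b] as well. *)
Let cdf_dist_le x :
  (`|P x - Q x|%:E <=
   \int[lebesgue_measure]_(u in `]b, +oo[) (gap u * \1_(`[x, +oo[) u)%:E)%E.
Proof.
have gap1_ge0 u : (0 <= (gap u * \1_(`[x, +oo[) u)%:E)%E.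
  by rewrite lee_fin mulr_ge0.
have mgap1 : measurable_fun (`]b, +oo[ : set R)
    (fun u => (gap u * \1_(`[x, +oo[) u)%:E).
  apply/measurable_EFinP; apply: measurable_funM.
    exact/measurable_EFinP.
  exact: measurable_indic.
have [xb|bx] := leP x b; last first.
  apply: (le_trans (cdf_dist_tail bx)).
  under eq_integral => u ux do
    rewrite -[gap u]mulr1 -[1]/(true%:R : R) -ux -[_%:R]/(\1_(`[x, +oo[) u : R).
  apply: ge0_subset_integral => // u/=.
  by rewrite !in_itv/= !andbT; exact: lt_le_trans.
(* [Q] has starting mass 0, hence no atom at [b]. *)
have Qb : Q b = 0 by rewrite (cdf_aboveE hQ)// set_itv1 Rintegral_set1 addr0.
have Qx : Q x = 0.
  by apply/le_anti; rewrite cumulative01_ge0 -[leRHS]Qb cumulative_is_nondecreasing.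
rewrite Qx subr0 ger0_norm ?cumulative01_ge0//.
set G := (X in (_ <= X)%E).
have [Gfin|] := ltP G +oo%E; last by rewrite leye_eq => /eqP ->; rewrite leey.
have Gf : G \is a fin_num by rewrite ge0_fin_numE// integral_ge0.
rewrite -(fineK Gf) lee_fin -[leRHS]addr0 -[X in _ + X]Qb.
(* For [y > b], [P x <= P y <= |P y - Q y| + Q y], and the tail bound applies at [y]. As [y]
   decreases to [b], [Q y] tends to [Q b = 0]. *)
apply: (@ler_cvg_to _ b^'+ _ _ (cst (P x)) (fun y => fine G + Q y)).
- exact: cvg_cst.
- by apply: cvgD; [exact: cvg_cst|exact: cumulative_is_right_continuous].
- near=> y.
  have yb : b < y by [].
  apply: (@le_trans _ _ (P y)).
    by apply: cumulative_is_nondecreasing; rewrite (le_trans xb)// ltW.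
  rewrite -lerBlDr; apply: le_trans (ler_norm _) _.
  rewrite -lee_fin (fineK Gf); apply: (le_trans (cdf_dist_tail yb)).
  have yx u : y <= u -> x <= u by apply: le_trans; exact/(le_trans xb)/ltW.
  apply: (@le_trans _ _ (\int[lebesgue_measure]_(u in `[y, +oo[)
      (gap u * \1_(`[x, +oo[) u)%:E)%E).
    rewrite le_eqVlt; apply/orP; left; apply/eqP; apply: eq_integral => u.
    rewrite inE/= in_itv/= andbT => /yx xu.
    by rewrite indicE mem_set/= ?in_itv/= ?xu// mulr1.
  apply: ge0_subset_integral => // u/=.
  by rewrite !in_itv/= !andbT; exact: lt_le_trans.
Unshelve. all: end_near. Qed.

(** Both sides are [|q P - Q p| / P] at [u], because [q u] and [P u] are positive. *)
Let gapE u : b < u ->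
  `|1 - reverse_hazard P a%:E p u / reverse_hazard Q b%:E q u| * q u = gap u.
Proof.
move=> bu; have au := le_lt_trans ab bu.
have Pu := cdf_gt0 hP au; have Qu := cdf_gt0 hQ bu.
have qu : 0 < q u by apply: (pdf_gt0 hQ); rewrite lte_fin.
rewrite /reverse_hazard !indicE !mem_set/= ?lte_fin// !mulr1.
rewrite -{2}(gtr0_norm qu) /gap -{2}(gtr0_norm Pu) -!normrM; congr (`| _ |).
by rewrite /dratio; field; rewrite !gt_eqF.
Qed.

Lemma integral_cdf_dist : 0 <= a ->
  (\int[lebesgue_measure]_x (`|P x - Q x|)%:E <= Delta_w Q b%:E q P a%:E p)%E.
Proof.
move=> a0.
have -> : Delta_w Q b%:E q P a%:E p =
    (\int[lebesgue_measure]_(u in `]b, +oo[) (u * gap u)%:E)%E.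
  rewrite /Delta_w (_ : [set x | _] = `]b, +oo[%classic); last first.
    by apply/seteqP; split=> u/=; rewrite in_itv/= andbT lte_fin.
  apply: eq_integral => u; rewrite inE/= in_itv/= andbT => bu.
  by rewrite -mulrA gapE.
(* The section of [A] at a given [u >= 0] is [[0, u]], whose length is the weight [u] of
   [Delta_w]. *)
pose A : set (measurableTypeR R * measurableTypeR R) :=
  [set z | (0 <= z.1) && (z.1 <= z.2)].
have mA : measurable A.
  pose c (z : measurableTypeR R * measurableTypeR R) := (0 <= z.1) && (z.1 <= z.2).
  have mc : measurable_fun setT c.
    by apply: measurable_and; apply: measurable_fun_ler.
  rewrite (_ : A = setT `&` c @^-1` [set true]); first exact: mc.
  by rewrite setTI; apply/seteqP; split.
(* Extending [gap] by 0 lets both iterated integrals run over the whole line. *)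
pose h (z : measurableTypeR R * measurableTypeR R) : \bar R :=
  (((gap \_ `]b, +oo[) z.2)%:E * (\1_A z)%:E)%E.
have gap'0 u : 0 <= (gap \_ `]b, +oo[) u by rewrite patchE; case: ifP.
have mgap' : measurable_fun [set: measurableTypeR R] (gap \_ `]b, +oo[).
  have mb : measurable (`]b, +oo[ : set R) by exact: measurable_itv.
  by apply/(measurable_restrictT _ mb); exact/measurable_EFinP.
have h0 z : (0 <= h z)%E by rewrite mule_ge0// lee_fin.
have mh : measurable_fun setT h.
  apply: emeasurable_funM; apply/measurable_EFinP.
    exact: (measurableT_comp mgap' measurable_snd).
  exact: measurable_indic.
apply: (@le_trans _ _ (\int[lebesgue_measure]_x \int[lebesgue_measure]_u h (x, u))%E).
  apply: ge0_le_integral => //.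
  - apply/measurable_EFinP; apply: measurableT_comp => //.
    by apply: measurable_funB; exact: measurable_cdf.
  - exact: measurable_fun_fubini_tonelli_F.
  (* For [x < 0] both cdfs vanish, since [0 <= a <= b]. *)
  - move=> x _; have [x0|x0] := ltP x 0.
      rewrite (cdf_below hP) ?(cdf_below hQ) ?lte_fin ?(lt_le_trans x0)//.
        by rewrite subrr normr0 integral_ge0.
      exact: le_trans ab.
    apply: (le_trans (cdf_dist_le x)).
    rewrite integral_mkcond le_eqVlt; apply/orP; left; apply/eqP.
    apply: eq_integral => u _; rewrite /h/= !patchE; case: ifP => ub; last by rewrite mul0e.
    rewrite EFinM !indicE; congr (_ * (_ %:R)%:E)%E.
    by congr nat_of_bool; apply/idP/idP; rewrite !inE/= in_itv/= andbT /A/= x0.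
rewrite fubini_tonelli// [leRHS]integral_mkcond le_eqVlt; apply/orP; left; apply/eqP.
apply: eq_integral => u _.
have m0u : measurable (`[0, u] : set (measurableTypeR R)) by exact: measurable_itv.
transitivity (\int[lebesgue_measure]_x
    (((gap \_ `]b, +oo[) u)%:E * (\1_(`[0, u] : set (measurableTypeR R)) x)%:E))%E.
  by apply: eq_integral => x _; rewrite /h/= !indicE; congr (_ * (_ %:R)%:E)%E.
rewrite ge0_integralZl//; last 2 first.
- by apply/measurable_EFinP; exact: measurable_indic.
- by rewrite lee_fin.
rewrite !patchE; case: ifP => ub; last by rewrite mul0e.
have u0 : 0 < u.
  by move: ub; rewrite inE/= in_itv/= andbT; apply: le_lt_trans; exact: le_trans ab.
rewrite integral_indic// setIT.
have := lebesgue_measure_itv `[0, u]; rewrite /= lte_fin u0 oppr0 adde0 => ->.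
by rewrite -EFinM mulrC.
Qed.

End comparison.

(** * Reduction to real endpoints and weakening of the sharper bound *)

Theorem theorem2p3 (R : realType) (P Q : cdfType R) (p0 q0 : R)
    (cP cQ : \bar R) (p q : R -> R)
    (hP : has_pdf P p0 cP p) (hQ : has_pdf Q q0 cQ q)
    (hp0 : p0 = 0%R) (hc : (cP <= cQ)%E)
    (hmP : finite_mean P) (hmQ : finite_mean Q)
    (hcP : (0 <= cP)%E) (hq0 : q0 = 0%R) :
  (Wass P Q <= 2%:E * mean P * Delta Q cQ q P cP p
               + 3%:E * Delta_w Q cQ q P cP p)%E.
Proof.
(* Both endpoints are real: +oo is excluded by [left_endpoint_lty], -oo by [0 <= cP <= cQ]. *)
case: cP hP hc hcP => [a| |] hP hc hcP //; last by have := left_endpoint_lty hP.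
case: cQ hQ hc => [b| |] hQ hc //; last by have := left_endpoint_lty hQ.
rewrite {}hp0 in hP; rewrite {}hq0 in hQ; rewrite !lee_fin in hc hcP.
have Dw0 : (0 <= Delta_w Q b%:E q P a%:E p)%E.
  apply: integral_ge0 => x /=; rewrite !lte_fin => bx.
  rewrite lee_fin !mulr_ge0 ?(pdf_ge0 hQ)//.
  by rewrite (le_trans hcP)// (le_trans hc)// ltW.
have D0 : (0 <= Delta Q b%:E q P a%:E p)%E.
  by apply: integral_ge0 => x _; rewrite lee_fin mulr_ge0 ?(pdf_ge0 hQ).
have mu0 : (0 <= mean P)%E.
  apply: mean_ge0 => // x x0.
  by rewrite (cdf_below hP)// lte_fin (lt_le_trans x0).
apply: (le_trans (Wass_le hmP hmQ)).
apply: (le_trans (integral_cdf_dist hP hQ hc hcP)).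
(* The bound [Delta_w] is enlarged to its triple, then by the nonnegative term in [Delta]. *)
apply: (@le_trans _ _ (3%:E * Delta_w Q b%:E q P a%:E p)%E).
  by rewrite -[leLHS]mul1e lee_wpmul2r// lee_fin ler1n.
by rewrite leeDr// !mule_ge0.
Qed.
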